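(* Let $P,F\in\mathrm{SpGr}(2n,2k)$. If for $$\tilde\Omega:=2\,\mathrm{cay}^{-1}\left(\mathrm{sqrt_m}\left((I_{2n}-2F)(I_{2n}-2P)\right)\right)$$ it holds that $\tilde\Omega\in\mathfrak{sp}_P(2n)$, then $F=\mathcal{R}^{\mathrm{SpGr}}_P([\tilde\Omega,P])$.
   Context: Let $k\le n$ be positive integers, $J_{2m}=\begin{bmatrix}0&I_m\\-I_m&0\end{bmatrix}$, and for a real $2a\times 2b$ matrix $A$ put $A^+:=J_{2b}^TA^TJ_{2a}$. $\mathfrak{sp}(2n,\mathbb{R})=\{\Omega\in\mathbb{R}^{2n\times2n}:\Omega^+=-\Omega\}$. $\mathrm{SpGr}(2n,2k)=\{P\in\mathbb{R}^{2n\times2n}: P^2=P,\ \mathrm{rank}(P)=2k,\ P^+=P\}$. For $P\in\mathrm{SpGr}(2n,2k)$, $\mathfrak{sp}_P(2n)=\{\tilde\Omega\in\mathfrak{sp}(2n,\mathbb{R}):\tilde\Omega=\tilde\Omega P+P\tilde\Omega\}$, and $T_P\mathrm{SpGr}(2n,2k)=\{[\tilde\Omega,P]:\tilde\Omega\in\mathfrak{sp}_P(2n)\}$, where $[\cdot,\cdot]$ is the matrix commutator. $\mathrm{sqrt_m}$ is the principal matrix square root. The Cayley transform is $\mathrm{cay}(X)=(I+X)(I-X)^{-1}$, with inverse $\mathrm{cay}^{-1}(M)=(M-I)(I+M)^{-1}$. The retraction on $\mathrm{SpGr}(2n,2k)$ is $\mathcal{R}^{\mathrm{SpGr}}_P(\Gamma)=\mathrm{cay}\left(\frac12[\Gamma,P]\right)P\,\mathrm{cay}\left(-\frac12[\Gamma,P]\right)$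 for $\Gamma\in T_P\mathrm{SpGr}(2n,2k)$. The hypothesis $\tilde\Omega\in\mathfrak{sp}_P(2n)$ includes that the expression defining $\tilde\Omega$ is well defined. *)

(* Defs.v *)
From mathcomp Require Import all_boot all_order all_algebra.
From mathcomp Require Import reals complex.

Set Implicit Arguments.
Unset Strict Implicit.
Unset Printing Implicit Defensive.

Import GRing.Theory Num.Theory.
Local Open Scope ring_scope.

(* Matrices of even size 2a x 2b have type 'M[R]_(a + a, b + b), so that the
   block structure of J_{2m} is visible to block_mx. *)
Section SymplecticGrassmann.
Variable R : realType.

Definition Jmx (m : nat) : 'M[R]_(m + m) :=
  block_mx 0 1%:M (- 1%:M) 0.

Definition sympl_inv (a b : nat) (A : 'M[R]_(a + a, b + b)) :
    'M[R]_(b + b, a + a) :=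
  (Jmx b)^T *m A^T *m Jmx a.

Definition lie_mx (m : nat) (A B : 'M[R]_m) : 'M[R]_m := A *m B - B *m A.

Definition sp (n : nat) (Om : 'M[R]_(n + n)) : Prop := sympl_inv Om = - Om.

Definition SpGr (n k : nat) (P : 'M[R]_(n + n)) : Prop :=
  [/\ P *m P = P, \rank P = (2 * k)%N & sympl_inv P = P].

Definition sp_at (n : nat) (P Om : 'M[R]_(n + n)) : Prop :=
  sp Om /\ Om = Om *m P + P *m Om.

Definition tangent_SpGr (n : nat) (P G : 'M[R]_(n + n)) : Prop :=
  exists2 Om, sp_at P Om & G = lie_mx Om P.

(* S is the principal square root of A: the square root all of whose complex
   eigenvalues lie in the open right half-plane.  There is at most one such S,
   and one exists exactly when A has no eigenvalue in ]-oo, 0]; the principal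
   square root of a real matrix is real, so S may be taken real. *)
Definition principal_sqrtm (m : nat) (A S : 'M[R]_m) : Prop :=
  S *m S = A /\
  forall z : R[i],
    eigenvalue (map_mx (real_complex R) S) z -> 0 < complex.Re z.

(* invmx is total, with invmx A = A for singular A: cay X is meaningful when
   1%:M - X is invertible, and cay_inv M when 1%:M + M is. *)
Definition cay (m : nat) (X : 'M[R]_m) : 'M[R]_m :=
  (1%:M + X) *m invmx (1%:M - X).

Definition cay_inv (m : nat) (M : 'M[R]_m) : 'M[R]_m :=
  (M - 1%:M) *m invmx (1%:M + M).

Definition cay_defined (m : nat) (X : 'M[R]_m) : Prop :=
  1%:M - X \in unitmx.

Definition retr_SpGr (n : nat) (P G : 'M[R]_(n + n)) : 'M[R]_(n + n) :=
  cay (2^-1 *: lie_mx G P) *m P *m cay (- (2^-1 *: lie_mx G P)).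

Definition retr_SpGr_defined (n : nat) (P G : 'M[R]_(n + n)) : Prop :=
  [/\ tangent_SpGr P G, cay_defined (2^-1 *: lie_mx G P)
    & cay_defined (- (2^-1 *: lie_mx G P))].

End SymplecticGrassmann.

(* Main.v *)
Require Import Defs.
From mathcomp Require Import all_boot all_order all_algebra.
From mathcomp Require Import reals complex.

Set Implicit Arguments.
Unset Strict Implicit.
Unset Printing Implicit Defensive.

Import GRing.Theory Num.Theory.
Local Open Scope ring_scope.

(** To an idempotent [P] belongs the involution [J = 1 - 2P], and [P] is
    recovered from [J].  The condition [Om = Om P + P Om] says exactly that [Om]
    anticommutes with [J], and for such [Om] the double bracket [[Om, P], P] is
    [Om] itself.  Hence the retraction at [[Om, P]] conjugates [P] by the Cayley
    transform of [Om / 2 = cay_inv S], which is [S]; since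
    [cay (- X) = (cay X)^-1], the retraction equals [S P S^-1].

    Anticommutation of [Om] with [J] turns into [S J = J S^-1]
    ([cay_anticomm]).  Therefore
    [S J S^-1 = S^2 J = (1 - 2F) J^2 = 1 - 2F], that is, [S P S^-1 = F].

    Two inverses have to exist.  [1 + S] is invertible because [-1] lies outside
    the open right half-plane; this makes [1 - Om / 2 = 2 (1 + S)^-1]
    invertible.  [S] is invertible because its square is a product of two
    involutions; this makes [1 + Om / 2 = 2 S (1 + S)^-1] invertible. *)

(** A singular [1 + S] would give [S] the eigenvalue [-1]. *)
Lemma principal_sqrtm_unit1D (R : realType) (m : nat) (A S : 'M[R]_m) :
  principal_sqrtm A S -> 1%:M + S \in unitmx.
Proof.
case=> _ ReS; apply: contraT => nU.
have : eigenvalue (map_mx (real_complex R) S) (- 1).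
  rewrite /eigenvalue /eigenspace kermx_eq0 row_free_unit.
  suff -> : map_mx (real_complex R) S - (- 1)%:M
      = map_mx (real_complex R) (1%:M + S) by rewrite map_unitmx.
  by rewrite map_mxD map_mx1 rmorphN opprK addrC.
by move/ReS => /=; rewrite ltr0N1.
Qed.

Lemma cay_inv_1B (R : realType) (m : nat) (S : 'M[R]_m) :
  1%:M + S \in unitmx -> 1%:M - cay_inv S = 2 *: invmx (1%:M + S).
Proof.
move=> U; rewrite /cay_inv -{1}(mulmxV U) -mulmxBl.
by rewrite opprB addrACA subrr addr0 scaler_nat mulr2n mulmxDl !mul1mx.
Qed.

Lemma cay_inv_1D (R : realType) (m : nat) (S : 'M[R]_m) :
  1%:M + S \in unitmx -> 1%:M + cay_inv S = 2 *: (S *m invmx (1%:M + S)).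
Proof.
move=> U; rewrite /cay_inv -{1}(mulmxV U) -mulmxDl.
by rewrite addrC addrA subrK scaler_nat mulr2n mulmxDl.
Qed.

Lemma cay_invK (R : realType) (m : nat) (S : 'M[R]_m) :
  1%:M + S \in unitmx -> cay (cay_inv S) = S.
Proof.
move=> U; rewrite /cay cay_inv_1B // cay_inv_1D //.
have U2 : (2 : R) \is a GRing.unit by rewrite unitfE pnatr_eq0.
rewrite invmxZ ?unitmxZ ?unitmx_inv // invmxK.
by rewrite -scalemxAl -scalemxAr scalerA divrr // scale1r mulmxKV.
Qed.

Lemma cayN (R : realType) (m : nat) (X : 'M[R]_m) :
  1%:M - X \in unitmx -> 1%:M + X \in unitmx ->
  cay (- X) *m cay X = 1%:M.
Proof.
by move=> UB UD; rewrite /cay opprK mulmxA mulmxKV // mulmxV.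
Qed.

(** [J] carries [1 - X] to [1 + X] and back, hence also their inverses. *)
Lemma cay_anticomm (R : realType) (m : nat) (J X : 'M[R]_m) :
  1%:M - X \in unitmx -> 1%:M + X \in unitmx ->
  J *m X = - (X *m J) -> cay X *m J = J *m cay (- X).
Proof.
move=> UB UD JX; rewrite /cay opprK.
have JB : J *m (1%:M - X) = (1%:M + X) *m J.
  by rewrite mulmxBr mulmxDl JX opprK mulmx1 mul1mx.
have JD : J *m (1%:M + X) = (1%:M - X) *m J.
  by rewrite mulmxDr mulmxBl JX mulmx1 mul1mx.
rewrite [RHS]mulmxA JB -!mulmxA; congr (_ *m _).
by rewrite -[RHS](mulKmx UB) (mulmxA _ J) -JD mulmxK.
Qed.

(** The double bracket is [X P - 2 P X P + P X], and multiplying the hypothesis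
    by [P] on both sides gives [P X P = 2 P X P], so the middle term vanishes. *)
Lemma lie_mx_idem2 (R : realType) (m : nat) (P X : 'M[R]_m) :
  P *m P = P -> X = X *m P + P *m X -> lie_mx (lie_mx X P) P = X.
Proof.
move=> PP XE.
have PXP : P *m X *m P = 0.
  have /eqP := congr1 (fun Y => P *m Y *m P) XE.
  rewrite mulmxDr mulmxDl !mulmxA PP -!mulmxA PP.
  by rewrite -subr_eq0 opprD addrA subrr sub0r oppr_eq0 => /eqP.
rewrite /lie_mx mulmxBl mulmxBr !mulmxA PXP subr0 sub0r opprK.
by rewrite PP -mulmxA PP.
Qed.

Lemma reflection_anticomm (R : realType) (m : nat) (P X : 'M[R]_m) :
  X = X *m P + P *m X ->
  (1%:M - 2 *: P) *m X = - (X *m (1%:M - 2 *: P)).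
Proof.
move=> XE; apply/eqP; rewrite -subr_eq0 opprK mulmxBl mulmxBr mul1mx mulmx1.
rewrite -scalemxAl -scalemxAr addrACA -opprD -scalerDr [_ *m X + _]addrC -XE.
by rewrite scaler_nat mulr2n subrr.
Qed.

Lemma reflectionK (R : realType) (m : nat) (P : 'M[R]_m) :
  P *m P = P -> (1%:M - 2 *: P) *m (1%:M - 2 *: P) = 1%:M.
Proof.
move=> PP; rewrite mulmxBl mul1mx -scalemxAl mulmxBr mulmx1 -scalemxAr PP.
have -> : P - 2 *: P = - P.
  by rewrite scaler_nat mulr2n opprD addrA subrr sub0r.
by rewrite scalerN opprK subrK.
Qed.

(* S stands for sqrt_m ((I - 2F)(I - 2P)).  Its spectrum lies in the open right
   half-plane, so 1%:M + S is invertible and cay_inv S is well defined.  The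
   conclusion includes that the retraction is defined at [Om, P]. *)
Theorem proposition5p6 (R : realType) (n k : nat)
    (k_gt0 : (0 < k)%N) (le_kn : (k <= n)%N)
    (P F : 'M[R]_(n + n)) (hP : SpGr k P) (hF : SpGr k F)
    (S : 'M[R]_(n + n))
    (hS : principal_sqrtm ((1%:M - 2 *: F) *m (1%:M - 2 *: P)) S) :
  let Om := 2 *: cay_inv S in
  sp_at P Om ->
  retr_SpGr_defined P (lie_mx Om P) /\ F = retr_SpGr P (lie_mx Om P).
Proof.
move=> Om [spOm OmE].
have [PP _ _] := hP; have [FF _ _] := hF; have [SS _] := hS.
have lieOm : lie_mx (lie_mx Om P) P = Om by apply: lie_mx_idem2.
have U2 : (2 : R) \is a GRing.unit by rewrite unitfE pnatr_eq0.
set X := cay_inv S; set J := 1%:M - 2 *: P.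
have halfOm : 2^-1 *: Om = X by rewrite scalerA mulVr // scale1r.
have U1S : 1%:M + S \in unitmx by apply: principal_sqrtm_unit1D hS.
have US : S \in unitmx.
  have : S *m S \in unitmx.
    rewrite SS unitmx_mul.
    by rewrite !(proj1 (mulmx1_unit (reflectionK _))).
  by rewrite unitmx_mul andbb.
have UB : 1%:M - X \in unitmx by rewrite cay_inv_1B // unitmxZ // unitmx_inv.
have UD : 1%:M + X \in unitmx.
  by rewrite cay_inv_1D // unitmxZ // unitmx_mul US unitmx_inv.
rewrite /retr_SpGr_defined /retr_SpGr /cay_defined lieOm halfOm opprK.
split; first by split=> //; exists Om.
have cayX : cay X = S by apply: cay_invK.
have cayNX : cay (- X) *m S = 1%:M by rewrite -(cayN UB UD) cayX.
have JX : J *m X = - (X *m J).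
  apply: reflection_anticomm.
  by rewrite -halfOm -scalemxAl -scalemxAr -scalerDr -OmE.
have SJ : S *m J = J *m cay (- X) by rewrite -cayX cay_anticomm.
have SJS : S *m J *m cay (- X) = 1%:M - 2 *: F.
  by rewrite -mulmxA -SJ mulmxA SS -mulmxA reflectionK // mulmx1.
have := SJS; rewrite mulmxBr mulmxBl mulmx1 (mulmx1C cayNX).
move/addrI/oppr_inj; rewrite -scalemxAr -scalemxAl => /(scalerI _) <- //.
  by rewrite cayX.
by rewrite pnatr_eq0.
Qed.
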